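(* Let $d\ge1$ be an integer. There is no resolvent-splitting without lifting for the problem class (3op-$\mathbb{R}^d$); that is, there is no pair $(T,S)$ with $T,S\in\mathcal{G}$ that is a fixed-point encoding for (3op-$\mathbb{R}^d$).
   Context: $\mathcal{M}(\mathbb{R}^d)$ is the set of all maximal monotone (set-valued) operators on $\mathbb{R}^d$ (with the Euclidean inner product). For $A\in\mathcal{M}(\mathbb{R}^d)$ and $\alpha>0$, $J_{\alpha A}=(I+\alpha A)^{-1}:\mathbb{R}^d\to\mathbb{R}^d$ is the resolvent. Problem class (3op-$\mathbb{R}^d$): all problems of finding $x\in\mathbb{R}^d$ with $0\in(A+B+C)x$, where $A,B,C\in\mathcal{M}(\mathbb{R}^d)$. Fixed-point encoding (without lifting): a pair $(T,S)$ with $T,S:\mathcal{M}(\mathbb{R}^d)^3\times\mathbb{R}^d\to\mathbb{R}^d$ is a fixed-point encoding for (3op-$\mathbb{R}^d$) if for all $A,B,C\in\mathcal{M}(\mathbb{R}^d)$ and all $x^\star\in\mathbb{R}^d$: there exists $z^\star\in\mathbb{R}^d$ with $T(A,B,C,z^\star)=z^\star$ and $S(A,B,C,z^\star)=x^\star$ if and only if $0\in(A+B+C)(x^\star)$. The class $\mathcal{G}$: consider maps $\mathcal{M}(\mathbb{R}^d)^3\times\mathbb{R}^d\to\mathbb{R}^d$. Let $I(A,B,C,z)=z$, $J_{\alpha,1}(A,B,C,z)=J_{\alpha A}(z)$, $J_{\beta,2}(A,B,C,z)=J_{\beta B}(z)$, $J_{\gamma,3}(A,B,C,z)=J_{\gamma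 C}(z)$. Composition is $(F\circ G)(A,B,C,z)=F(A,B,C,G(A,B,C,z))$. Let $\mathcal{G}_0=\{I\}\cup\{J_{\alpha,1}:\alpha>0\}\cup\{J_{\beta,2}:\beta>0\}\cup\{J_{\gamma,3}:\gamma>0\}$, and recursively $\mathcal{G}_{i+1}=\{F+G: F,G\in\mathcal{G}_i\}\cup\{F\circ G:F,G\in\mathcal{G}_i\}\cup\{\gamma F:F\in\mathcal{G}_i,\gamma\in\mathbb{R}\}$, and $\mathcal{G}=\bigcup_{i\ge0}\mathcal{G}_i$. $(T,S)$ is a resolvent-splitting without lifting for (3op-$\mathbb{R}^d$) if it is a fixed-point encoding for (3op-$\mathbb{R}^d$) and $T,S\in\mathcal{G}$. *)

(* Defs.v *)
From mathcomp Require Import all_boot all_order all_algebra.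
From mathcomp Require Import boolp classical_sets reals.

Set Implicit Arguments.
Unset Strict Implicit.
Unset Printing Implicit Defensive.

Import Order.TTheory GRing.Theory Num.Theory.

Local Open Scope classical_set_scope.
Local Open Scope ring_scope.

Section Operators.
Variables (R : realType) (d : nat).
Local Notation V := 'rV[R]_d.

Definition dot (u v : V) : R := \sum_(i < d) u 0 i * v 0 i.

Definition operator := V -> set V.

Definition op_id : operator := fun x => [set x].
Definition op_add (A B : operator) : operator :=
  fun x => [set u + v | u in A x & v in B x].
Definition op_scale (a : R) (A : operator) : operator :=
  fun x => [set a *: u | u in A x].
Definition op_inv (A : operator) : operator := fun u => [set x | A x u].

Definition monotone (A : operator) : Prop :=
  forall x y u v, A x u -> A y v -> 0 <= dot (u - v) (x - y).

Definition maximal_monotone (A : operator) : Prop :=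
  monotone A /\
  forall B : operator, monotone B -> (forall x, A x `<=` B x) -> B = A.

Record maxmon := MaxMon {
  maxmon_op :> operator;
  maxmonP : maximal_monotone maxmon_op }.

(* For A maximal monotone and alpha > 0, the set (I + alpha A)^-1 z is a
   singleton (Minty), so xget returns its unique element and the default value
   0 is never used. *)
Definition resolvent (alpha : R) (A : operator) (z : V) : V :=
  xget 0 (op_inv (op_add op_id (op_scale alpha A)) z).

Definition opmap := maxmon -> maxmon -> maxmon -> V -> V.

Definition map_id : opmap := fun A B C z => z.
Definition map_J1 (alpha : R) : opmap := fun A B C z => resolvent alpha A z.
Definition map_J2 (beta : R) : opmap := fun A B C z => resolvent beta B z.
Definition map_J3 (gamma : R) : opmap := fun A B C z => resolvent gamma C z.

Definition map_add (F G : opmap) : opmap :=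
  fun A B C z => F A B C z + G A B C z.
Definition map_comp (F G : opmap) : opmap :=
  fun A B C z => F A B C (G A B C z).
Definition map_scale (a : R) (F : opmap) : opmap :=
  fun A B C z => a *: F A B C z.

Fixpoint Gclass_rec (i : nat) : set opmap :=
  match i with
  | 0%N => [set map_id]
           `|` [set map_J1 alpha | alpha in [set a : R | 0 < a]]
           `|` [set map_J2 beta | beta in [set a : R | 0 < a]]
           `|` [set map_J3 gamma | gamma in [set a : R | 0 < a]]
  | j.+1 => [set map_add F G | F in Gclass_rec j & G in Gclass_rec j]
            `|` [set map_comp F G | F in Gclass_rec j & G in Gclass_rec j]
            `|` [set map_scale a F | a in [set: R] & F in Gclass_rec j]
  end.

Definition Gclass : set opmap := \bigcup_i Gclass_rec i.

Definition fixed_point_encoding (T S : opmap) : Prop :=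
  forall (A B C : maxmon) (xstar : V),
    (exists zstar : V, T A B C zstar = zstar /\ S A B C zstar = xstar)
    <-> op_add (op_add A B) C xstar 0.

Definition resolvent_splitting (T S : opmap) : Prop :=
  [/\ fixed_point_encoding T S, Gclass T & Gclass S].

End Operators.

(* Main.v *)
Require Import Defs.
From mathcomp Require Import all_boot all_order all_algebra.
From mathcomp Require Import boolp classical_sets reals.
From mathcomp Require Import ring.

(** Feed the encoding the normal cones of three singletons [{p}], [{q}], [{r}].
    The resolvent of the normal cone of [{p}] is the constant map [p], whatever
    the step size, so every map of the class restricts on these operators to an
    affine form [t z + a p + b q + c r] whose scalar coefficients depend on the
    map only ([Gclass_affine]).  On the other hand, the domain of the sum of
    the three cones is the intersection of the singletons: unless [p = q = r]
    there is no solution, and hence [T] must have no fixed point.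

    A single linear equation [a x + b y + c w = 0] cuts out a space of dimension
    at least two in the space of triples of scalars, so for the coefficients of
    [T] it has a solution off the diagonal ([linear_form3_kernel]).  Multiplying
    this solution by a nonzero vector gives points [p, q, r], not all equal, for
    which [T] is the homothety [z |-> t z].  It fixes [0], and [S] turns this
    fixed point into a solution of a problem without solutions. *)

Import Order.TTheory GRing.Theory Num.Theory.
Local Open Scope classical_set_scope.
Local Open Scope ring_scope.

Section SingletonCones.
Variables (R : realType) (d : nat).
Local Notation V := 'rV[R]_d.
Implicit Types p q r x z : V.

Lemma dot_self_le0 x : dot x x <= 0 -> x = 0.
Proof.
move=> x_le0.
have sq_ge0 (i : 'I_d) : 0 <= x 0 i * x 0 i by rewrite -expr2 sqr_ge0.
have /eqP : dot x x == 0 by rewrite eq_le x_le0 sumr_ge0.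
rewrite /dot => /psumr_eq0P x0; apply/rowP => i; rewrite mxE.
by have /eqP := x0 (fun i _ => sq_ge0 i) i isT; rewrite mulf_eq0 orbb => /eqP.
Qed.

Lemma dotNl x z : dot (- x) z = - dot x z.
Proof. by rewrite /dot -sumrN; apply: eq_bigr => i _; rewrite mxE mulNr. Qed.

(** The subdifferential of the indicator function of [{p}]. *)
Definition singleton_cone p : operator R d := fun x => [set u | x = p].

(** A pair [(y, v)] monotonically related to the whole vertical line above [p]
    is in particular related to [(p, v - (p - y))], which forces
    [- |p - y|^2 >= 0]. *)
Lemma singleton_cone_maximal p : maximal_monotone (singleton_cone p).
Proof.
split=> [x y u v /= -> ->|B monB subB].
  by rewrite /dot sumr_ge0 // => i _; rewrite subrr !mxE mulr0.
apply/funext => y; apply/seteqP; split=> [v Byv|]; last exact: subB.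
have := monB p y (v - (p - y)) v (subB p _ erefl) Byv.
rewrite [v - _]addrC addrK dotNl oppr_ge0 => /dot_self_le0 /eqP.
by rewrite subr_eq0 eq_sym => /eqP.
Qed.

Definition singleton_maxmon p : maxmon R d := MaxMon (singleton_cone_maximal p).

Lemma resolvent_singleton (alpha : R) p z :
  0 < alpha -> resolvent alpha (singleton_maxmon p) z = p.
Proof.
move=> alpha_gt0; rewrite /resolvent.
have in_res : op_inv (op_add (@op_id R d)
    (op_scale alpha (singleton_maxmon p))) z p.
  exists p => //; exists (z - p); last by rewrite addrC subrK.
  by exists (alpha^-1 *: (z - p)); rewrite // scalerA divff ?scale1r ?gt_eqF.
by case: xgetP => [x _ [_ _ [_ [_ /= -> _] _]] //|/(_ p)].
Qed.

Lemma singleton_zero p q r x :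
  op_add (op_add (singleton_maxmon p) (singleton_maxmon q))
    (singleton_maxmon r) x 0 -> p = q /\ q = r.
Proof. by case=> _ [_ /= <- [_ <- _]] [_ <- _]. Qed.

(** On these operators the generators are the identity and three constant maps,
    and affine forms are closed under sums, compositions and scalings.  The
    quantifiers matter: the coefficients are chosen before [p, q, r], so that
    [p, q, r] can later be adapted to them. *)
Lemma Gclass_affine (F : opmap R d) : Gclass F ->
  exists t a b c : R, forall p q r z,
    F (singleton_maxmon p) (singleton_maxmon q) (singleton_maxmon r) z
    = t *: z + (a *: p + b *: q + c *: r).
Proof.
case=> n _; elim: n F => [|n IHn] F /=.
  case=> [[[->|[al al_gt0 <-]]|[al al_gt0 <-]]|[al al_gt0 <-]].
  - by exists 1, 0, 0, 0 => p q r z; rewrite !scale0r !addr0 scale1r.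
  - exists 0, 1, 0, 0 => p q r z.
    by rewrite /map_J1 resolvent_singleton // !scale0r scale1r add0r !addr0.
  - exists 0, 0, 1, 0 => p q r z.
    by rewrite /map_J2 resolvent_singleton // !scale0r scale1r !add0r addr0.
  - exists 0, 0, 0, 1 => p q r z.
    by rewrite /map_J3 resolvent_singleton // !scale0r scale1r !add0r.
case=> [[[G /IHn[t [a [b [c GE]]]] [H /IHn[t' [a' [b' [c' HE]]]] <-]]
       |[G /IHn[t [a [b [c GE]]]] [H /IHn[t' [a' [b' [c' HE]]]] <-]]]
       |[k _ [G /IHn[t [a [b [c GE]]]] <-]]].
- exists (t + t'), (a + a'), (b + b'), (c + c') => p q r z.
  by rewrite /map_add GE HE; apply/rowP => i; rewrite !mxE; ring.
- exists (t * t'), (t * a' + a), (t * b' + b), (t * c' + c) => p q r z.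
  by rewrite /Defs.map_comp GE HE; apply/rowP => i; rewrite !mxE; ring.
- exists (k * t), (k * a), (k * b), (k * c) => p q r z.
  by rewrite /map_scale GE; apply/rowP => i; rewrite !mxE; ring.
Qed.

End SingletonCones.

(** The solution [(b, - a, 0)] lies on the diagonal only if [a = b = 0], and then
    the first unit vector is a solution. *)
Lemma linear_form3_kernel (F : fieldType) (a b c : F) :
  exists x y w : F, a * x + b * y + c * w = 0 /\ ~ (x = y /\ y = w).
Proof.
have [ab0|ab_neq0] := boolP ((a == 0) && (b == 0)).
  have [/eqP-> /eqP->] := andP ab0.
  by exists 1, 0, 0; split; [ring | case=> /eqP; rewrite oner_eq0].
exists b, (- a), 0; split; first by ring.
case=> b_eq /eqP; rewrite oppr_eq0 => /eqP a0.
by move: ab_neq0; rewrite b_eq a0 oppr0 eqxx.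
Qed.

Theorem theorem3 (R : realType) (d : nat) (hd : (1 <= d)%N) :
  ~ exists T S : opmap R d, resolvent_splitting T S.
Proof.
case=> T [S [enc /Gclass_affine[t [a [b [c TE]]]] _]].
have no_fix (p q r z : 'rV[R]_d) : ~ (p = q /\ q = r) ->
    t *: z + (a *: p + b *: q + c *: r) <> z.
  rewrite -TE => npqr Tz; apply: npqr.
  by apply: singleton_zero; apply/enc; exists z; split; first exact: Tz.
have [x [y [w [ker_xyw nxyw]]]] := linear_form3_kernel _ a b c.
pose e : 'rV[R]_d := const_mx 1.
have scale_e_inj k l : k *: e = l *: e -> k = l.
  by move/rowP/(_ (Ordinal hd)); rewrite !mxE !mulr1.
have npqr : ~ (x *: e = y *: e /\ y *: e = w *: e).
  by case=> /scale_e_inj xy /scale_e_inj yw; apply: nxyw.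
apply: (no_fix _ _ _ 0 npqr).
by rewrite scaler0 add0r !scalerA -!scalerDl ker_xyw scale0r.
Qed.
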